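(* Let $C$ be a graded coalgebra over $\mathbb{C}$ with coassociative graded coproduct $\Delta:C\to C\otimes C$, and let $\mathrm{d}:C\to C$ be an odd degree flat coderivation of $\Delta$. Then, with the Koszul sign convention, $$\Delta^{\mathrm{d}}:=\Delta+\mathrm{i}\hbar(\mathrm{d}\otimes\mathrm{d})\Delta$$ (extended $\mathbb{C}[[\hbar]]$-linearly to a map $C[[\hbar]]\to(C\otimes C)[[\hbar]]$) is a deformed coproduct: it is coassociative, $(\mathrm{id}\otimes\Delta^{\mathrm{d}})\Delta^{\mathrm{d}}=(\Delta^{\mathrm{d}}\otimes\mathrm{id})\Delta^{\mathrm{d}}$, and reduces to $\Delta$ at $\hbar=0$.
   Context: A flat coderivation is a homogeneous $\mathbb{C}$-linear map $\mathrm{d}:C\to C$ with $\mathrm{d}^2=0$ and $\Delta\mathrm{d}=(\mathrm{id}\otimes\mathrm{d})\Delta+(\mathrm{d}\otimes\mathrm{id})\Delta$. The Koszul sign convention is $(f\otimes g)(v\otimes w)=(-1)^{|g||v|}f(v)\otimes g(w)$ and $(f\otimes g)\circ(f'\otimes g')=(-1)^{|g||f'|}(f\circ f')\otimes(g\circ g')$ for homogeneous maps and elements, where $|\cdot|$ denotes degree. Here $\mathrm{i}=\sqrt{-1}$, $\hbar$ is a formal parameter, and $V[[\hbar]]$ denotes formal power series in $\hbar$ with coefficients in $V$; all maps are extended $\mathbb{C}[[\hbar]]$-linearly (coefficientwise) to power series, so that the coassociativity identity is one of maps $C[[\hbar]]\to(C\otimes C\otimes C)[[\hbar]]$. *)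

(* Defs.v *)
From HB Require Import structures.
From mathcomp Require Import all_boot all_order all_algebra finmap.
From mathcomp Require Import generic_quotient.
From mathcomp Require Import boolp classical_sets functions cardinality fsbigop.
From mathcomp Require Import reals complex.

Set Implicit Arguments.
Unset Strict Implicit.
Unset Printing Implicit Defensive.

Import GRing.Theory.
Local Open Scope classical_set_scope.
Local Open Scope ring_scope.

Section TensorConstruction.
Variables (K : fieldType) (V W : lmodType K).

(* A list [:: (v1, w1); ...; (vn, wn)] stands for the formal sum
   v1 (x) w1 + ... + vn (x) wn; the tensor product is the quotient of formal
   sums by the congruence generated by the bilinearity relations. *)
Inductive tens_eq : seq (V * W) -> seq (V * W) -> Prop :=
| tens_refl s : tens_eq s s
| tens_sym s t : tens_eq s t -> tens_eq t s
| tens_trans s t u : tens_eq s t -> tens_eq t u -> tens_eq s u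
| tens_cat s s' t t' : tens_eq s s' -> tens_eq t t' ->
    tens_eq (s ++ t) (s' ++ t')
| tens_catC s t : tens_eq (s ++ t) (t ++ s)
| tens_Dl v v' w : tens_eq [:: (v + v', w)] [:: (v, w); (v', w)]
| tens_Dr v w w' : tens_eq [:: (v, w + w')] [:: (v, w); (v, w')]
| tens_Z a v w : tens_eq [:: (a *: v, w)] [:: (v, a *: w)]
| tens_0 w : tens_eq [:: (0, w)] [::].

Definition tens_eqb (s t : seq (V * W)) : bool := `[< tens_eq s t >].

Lemma tens_eqb_refl : reflexive tens_eqb.
Proof. by move=> s; apply/asboolP; exact: tens_refl. Qed.

Lemma tens_eqb_sym : symmetric tens_eqb.
Proof. by move=> s t; apply/asboolP/asboolP; exact: tens_sym. Qed.

Lemma tens_eqb_trans : transitive tens_eqb.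
Proof.
by move=> t s u /asboolP st /asboolP tu; apply/asboolP; exact: tens_trans tu.
Qed.

Canonical tens_equiv := EquivRel tens_eqb tens_eqb_refl tens_eqb_sym tens_eqb_trans.

Definition tensor : Type := {eq_quot tens_equiv}%qT.

HB.instance Definition _ := Choice.on tensor.

Definition tens_of (s : seq (V * W)) : tensor := (\pi_({eq_quot tens_equiv}) s)%qT.
Definition tens_repr (t : tensor) : seq (V * W) := repr (t : {eq_quot tens_equiv}%qT).

Lemma tens_reprK : cancel tens_repr tens_of.
Proof. by move=> t; rewrite /tens_of /tens_repr reprK. Qed.

Lemma tens_ofP s t : tens_of s = tens_of t <-> tens_eq s t.
Proof.
split=> [/eqmodP/asboolP // | st].
by apply/eqmodP/asboolP.
Qed.

Lemma tens_of_repr s : tens_eq (tens_repr (tens_of s)) s.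
Proof. by apply/tens_ofP; rewrite tens_reprK. Qed.

Definition tens_scale_seq (a : K) (s : seq (V * W)) := [seq (a *: x.1, x.2) | x <- s].

Lemma tens_scale_eq a s t :
  tens_eq s t -> tens_eq (tens_scale_seq a s) (tens_scale_seq a t).
Proof.
elim=> {s t} [s|s t _|s t u _ + _|s s' t t' _ + _|s t|v v' w|v w w'|b v w|w] /=.
- exact: tens_refl.
- exact: tens_sym.
- exact: tens_trans.
- by rewrite /tens_scale_seq !map_cat; exact: tens_cat.
- by rewrite /tens_scale_seq !map_cat; exact: tens_catC.
- by rewrite scalerDr; exact: tens_Dl.
- exact: tens_Dr.
- by rewrite scalerA mulrC -scalerA; exact: tens_Z.
- by rewrite scaler0; exact: tens_0.
Qed.

Definition tens_add (s t : tensor) := tens_of (tens_repr s ++ tens_repr t).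
Definition tens_zero : tensor := tens_of [::].
Definition tens_scale a (t : tensor) := tens_of (tens_scale_seq a (tens_repr t)).
Definition tens_opp (t : tensor) := tens_scale (-1) t.

Lemma tens_addE s t : tens_add (tens_of s) (tens_of t) = tens_of (s ++ t).
Proof. by apply/tens_ofP/tens_cat; exact: tens_of_repr. Qed.

Lemma tens_scaleE a s : tens_scale a (tens_of s) = tens_of (tens_scale_seq a s).
Proof. by apply/tens_ofP/tens_scale_eq/tens_of_repr. Qed.

Lemma tens_ofW (P : tensor -> Prop) : (forall s, P (tens_of s)) -> forall t, P t.
Proof. by move=> Ps t; rewrite -[t]tens_reprK. Qed.

Lemma tens_addA : associative tens_add.
Proof.
elim/tens_ofW=> s; elim/tens_ofW=> t; elim/tens_ofW=> u.
by rewrite !tens_addE catA.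
Qed.

Lemma tens_addC : commutative tens_add.
Proof.
elim/tens_ofW=> s; elim/tens_ofW=> t.
by rewrite !tens_addE; apply/tens_ofP/tens_catC.
Qed.

Lemma tens_add0 : left_id tens_zero tens_add.
Proof. by elim/tens_ofW=> s; rewrite tens_addE. Qed.

Lemma tens_scaleDl_seq a b s :
  tens_eq (tens_scale_seq (a + b) s) (tens_scale_seq a s ++ tens_scale_seq b s).
Proof.
apply/tens_ofP; rewrite -tens_addE.
elim: s => [|[v w] s IH]; first by rewrite tens_addE.
have consE c : tens_of (tens_scale_seq c ((v, w) :: s)) =
    tens_add (tens_of [:: (c *: v, w)]) (tens_of (tens_scale_seq c s)).
  by rewrite tens_addE.
rewrite !consE IH scalerDl (proj2 (tens_ofP _ [:: (a *: v, w); (b *: v, w)])); last first.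
  exact: tens_Dl.
have -> : tens_of [:: (a *: v, w); (b *: v, w)] =
   tens_add (tens_of [:: (a *: v, w)]) (tens_of [:: (b *: v, w)]) by rewrite tens_addE.
rewrite -!tens_addA; congr tens_add.
by rewrite !tens_addA [tens_add _ (tens_of [:: (b *: v, w)])]tens_addC.
Qed.

Lemma tens_scale0 t : tens_scale 0 t = tens_zero.
Proof.
elim/tens_ofW: t => s; rewrite tens_scaleE.
elim: s => [//|[v w] s IH].
have -> : tens_of (tens_scale_seq 0 ((v, w) :: s)) =
    tens_add (tens_of [:: (0 *: v, w)]) (tens_of (tens_scale_seq 0 s)).
  by rewrite tens_addE.
rewrite IH scale0r (proj2 (tens_ofP _ [::]) (tens_0 w)).
exact: tens_add0.
Qed.

Lemma tens_scaleDl t a b :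
  tens_scale (a + b) t = tens_add (tens_scale a t) (tens_scale b t).
Proof.
elim/tens_ofW: t => s; rewrite !tens_scaleE tens_addE.
by apply/tens_ofP/tens_scaleDl_seq.
Qed.

Lemma tens_scale1 : left_id 1 tens_scale.
Proof.
elim/tens_ofW=> s; rewrite tens_scaleE /tens_scale_seq; congr tens_of.
by rewrite -[RHS]map_id; apply: eq_map => -[v w] /=; rewrite scale1r.
Qed.

Lemma tens_addN : left_inverse tens_zero tens_opp tens_add.
Proof.
move=> t; rewrite /tens_opp -{2}[t]tens_scale1 -tens_scaleDl addNr.
exact: tens_scale0.
Qed.

HB.instance Definition _ := GRing.isZmodule.Build tensor
  tens_addA tens_addC tens_add0 tens_addN.

Lemma tens_scaleA a b t : tens_scale a (tens_scale b t) = tens_scale (a * b) t.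
Proof.
elim/tens_ofW: t => s; rewrite !tens_scaleE /tens_scale_seq -map_comp.
by congr tens_of; apply: eq_map => -[v w] /=; rewrite scalerA.
Qed.

Lemma tens_scaleDr : right_distributive tens_scale +%R.
Proof.
move=> a; elim/tens_ofW=> s; elim/tens_ofW=> t.
by rewrite /GRing.add /= tens_addE !tens_scaleE tens_addE /tens_scale_seq map_cat.
Qed.

HB.instance Definition _ := GRing.Zmodule_isLmodule.Build K tensor
  tens_scaleA tens_scale1 tens_scaleDr (fun t a b => tens_scaleDl t a b).

Definition tpure (v : V) (w : W) : tensor := tens_of [:: (v, w)].

Lemma tpure_is_bilinear : bilinear_for *:%R *:%R tpure.
Proof.
have ZE a v w : a *: tpure v w = tpure (a *: v) w.
  by rewrite /GRing.scale /= tens_scaleE.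
split=> [w a v v'|v a w w'] /=; rewrite ZE.
  by rewrite /GRing.add /= tens_addE; apply/tens_ofP/tens_Dl.
have -> : tpure (a *: v) w = tpure v (a *: w) by apply/tens_ofP/tens_Z.
by rewrite {2}/GRing.add /= tens_addE; apply/tens_ofP/tens_Dr.
Qed.

HB.instance Definition _ :=
  bilinear_isBilinear.Build K V W tensor *:%R *:%R tpure tpure_is_bilinear.

Lemma tens_ofE s : tens_of s = \sum_(x <- s) tpure x.1 x.2.
Proof.
elim: s => [|[v w] s IH]; rewrite ?big_nil ?big_cons //=.
by rewrite -IH /GRing.add /= tens_addE.
Qed.

Section Lift.
Variables (U : lmodType K) (phi : {bilinear V -> W -> U}).

(* The linear map induced by phi through the universal property. *)
Definition tlift (t : tensor) : U := \sum_(x <- tens_repr t) phi x.1 x.2.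

Lemma tlift_eq s t : tens_eq s t ->
  \sum_(x <- s) phi x.1 x.2 = \sum_(x <- t) phi x.1 x.2.
Proof.
elim=> {s t} [//|s t _ ->//|s t u _ -> _ ->//
  |s s' t t' _ IHs _ IHt|s t|v v' w|v w w'|a v w|w].
- by rewrite !big_cat /= IHs IHt.
- by rewrite !big_cat /= addrC.
- by rewrite !big_cons !big_nil !addr0 /= linearDl.
- by rewrite !big_cons !big_nil !addr0 /= linearDr.
- by rewrite !big_cons !big_nil !addr0 /= linearZl_LR linearZr_LR.
- by rewrite !big_cons !big_nil !addr0 /= linear0l.
Qed.

Lemma tlift_of s : tlift (tens_of s) = \sum_(x <- s) phi x.1 x.2.
Proof. exact/tlift_eq/tens_of_repr. Qed.

Lemma tlift_pure v w : tlift (tpure v w) = phi v w.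
Proof. by rewrite tlift_of big_seq1. Qed.

Lemma tlift_is_linear : linear tlift.
Proof.
move=> a; elim/tens_ofW=> s; elim/tens_ofW=> t.
have -> : a *: tens_of s + tens_of t = tens_of (tens_scale_seq a s ++ t).
  by rewrite {1}/GRing.scale /= tens_scaleE {1}/GRing.add /= tens_addE.
rewrite !tlift_of big_cat /= big_map scaler_sumr.
by congr (_ + _); apply: eq_bigr => x _; rewrite linearZl_LR.
Qed.

HB.instance Definition _ :=
  GRing.isLinear.Build K tensor U *:%R tlift tlift_is_linear.

End Lift.

Lemma tensorW (P : tensor -> Prop) :
  P 0 -> (forall v w t, P t -> P (tpure v w + t)) -> forall t, P t.
Proof.
move=> P0 PD; elim/tens_ofW => s; rewrite tens_ofE.
by elim: s => [|x s IH]; rewrite ?big_nil // big_cons; exact: PD.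
Qed.

Lemma tens_linear_ext (U : lmodType K) (f g : {linear tensor -> U}) :
  (forall v w, f (tpure v w) = g (tpure v w)) -> f =1 g.
Proof.
move=> fg; elim/tensorW => [|v w t IH]; first by rewrite !linear0.
by rewrite !linearD fg IH.
Qed.

End TensorConstruction.

Notation "v '*t' w" := (tpure v w) (at level 40, left associativity) : ring_scope.

(* Z-graded vector spaces, as internal direct sums: every vector is uniquely
   a finite sum of homogeneous ones. *)
HB.mixin Record isGraded (K : fieldType) V of GRing.Lmodule K V := {
  gpiece : int -> set V;
  gpiece0 : forall n, gpiece n 0;
  gpieceP : forall n a u v, gpiece n u -> gpiece n v -> gpiece n (a *: u + v);
  gpiece_direct : forall v, exists! c : int -> V,
    [/\ forall n, gpiece n (c n), finite_set [set n | c n != 0]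
      & v = \sum_(n \in [set: int]) c n]
}.

#[short(type="gradedType")]
HB.structure Definition Graded (K : fieldType) :=
  {V of GRing.Lmodule K V & isGraded K V}.

Section FiniteSupport.
Variables (K : fieldType) (U : lmodType K).

Lemma fsum_fset (A : {fset int}) (c : int -> U) :
  (forall n, n \notin A -> c n = 0) -> \sum_(n \in [set: int]) c n = \sum_(n <- A) c n.
Proof. by move=> cA; exact: fsbigTE. Qed.

Lemma finite_supp_fset (c : int -> U) : finite_set [set n | c n != 0] ->
  exists A : {fset int}, forall n, n \notin A -> c n = 0.
Proof.
move=> /finite_fsetP[A AE]; exists A => n nA; apply/eqP/negPn/negP => cn.
by have : [set` A] n by [rewrite -AE]; rewrite /= (negbTE nA).
Qed.

Lemma finite_supp_sub (A : {fset int}) (c : int -> U) :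
  (forall n, n \notin A -> c n = 0) -> finite_set [set n | c n != 0].
Proof.
move=> cA; apply: (finite_subfset A) => n /= cn.
by apply: contraNT cn => /cA ->.
Qed.

End FiniteSupport.

Section Components.
Variables (K : fieldType) (V : gradedType K).

(* The component of v of degree n. *)
Definition gcomp (n : int) (v : V) : V := projT1 (cid (gpiece_direct v)) n.

Lemma gcomp_piece n v : gpiece n (gcomp n v).
Proof. by rewrite /gcomp; case: cid => c [[]]. Qed.

Lemma gcomp_supp v : finite_set [set n | gcomp n v != 0].
Proof. by rewrite /gcomp; case: cid => c [[]]. Qed.

Lemma gcomp_sum v : v = \sum_(n \in [set: int]) gcomp n v.
Proof. by rewrite /gcomp; case: cid => c [[]]. Qed.

Lemma gcomp_uniq v (c : int -> V) : (forall n, gpiece n (c n)) ->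
  finite_set [set n | c n != 0] -> v = \sum_(n \in [set: int]) c n ->
  forall n, gcomp n v = c n.
Proof. by rewrite /gcomp; case: cid => c' [_ c'u] cP cf cs n /=; rewrite (c'u c). Qed.

Lemma gcomp_fset v : exists A : {fset int}, forall n, n \notin A -> gcomp n v = 0.
Proof. exact/finite_supp_fset/gcomp_supp. Qed.

Lemma gcomp_is_linear n : linear (gcomp n).
Proof.
move=> a u v; have [A uA] := gcomp_fset u; have [B vB] := gcomp_fset v.
pose c m := a *: gcomp m u + gcomp m v.
have cAB m : m \notin (A `|` B)%fset -> c m = 0.
  by rewrite in_fsetU negb_or /c => /andP[/uA -> /vB ->]; rewrite scaler0 addr0.
apply: (@gcomp_uniq _ c).
- by move=> m; apply: gpieceP; exact: gcomp_piece.
- exact: finite_supp_sub cAB.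
rewrite (fsum_fset cAB) big_split /= -scaler_sumr {1}[u]gcomp_sum {1}[v]gcomp_sum.
rewrite (@fsum_fset _ _ (A `|` B)%fset); last first.
  by move=> m; rewrite in_fsetU negb_or => /andP[/uA].
rewrite (@fsum_fset _ _ (A `|` B)%fset) // => m.
by rewrite in_fsetU negb_or => /andP[_ /vB].
Qed.

HB.instance Definition _ n :=
  GRing.isLinear.Build K V V *:%R (gcomp n) (gcomp_is_linear n).

Lemma gcomp_hom n m v : gpiece n v -> gcomp m v = if m == n then v else 0.
Proof.
move=> nv; apply: (@gcomp_uniq v (fun m => if m == n then v else 0)).
- by move=> p; case: eqP => [->//|_]; exact: gpiece0.
- apply: (@finite_supp_sub _ _ [fset n]%fset) => p.
  by rewrite in_fset1 => /negbTE ->.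
rewrite (@fsum_fset _ _ [fset n]%fset) ?big_seq_fset1 ?eqxx // => p.
by rewrite in_fset1 => /negbTE ->.
Qed.

Variable U : lmodType K.

Lemma gsum_is_linear (F : int -> {linear V -> U}) :
  linear (fun v => \sum_(n \in [set: int]) F n (gcomp n v)).
Proof.
move=> a u v /=; have [A uA] := gcomp_fset u; have [B vB] := gcomp_fset v.
pose C := (A `|` B)%fset.
have uC m : m \notin C -> gcomp m u = 0.
  by rewrite in_fsetU negb_or => /andP[/uA].
have vC m : m \notin C -> gcomp m v = 0.
  by rewrite in_fsetU negb_or => /andP[_ /vB].
have E w : (forall m, m \notin C -> gcomp m w = 0) ->
   \sum_(n \in [set: int]) F n (gcomp n w) = \sum_(n <- C) F n (gcomp n w).
  by move=> wC; apply: fsum_fset => m /wC ->; rewrite linear0.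
rewrite (E u) // (E v) // (E (a *: u + v)); last first.
  by move=> m mC; rewrite linearP /= (uC m) // (vC m) // scaler0 addr0.
by rewrite scaler_sumr -big_split; apply: eq_bigr => m _; rewrite !linearP.
Qed.

Lemma gsum_hom n v (F : int -> V -> U) : (forall m, F m 0 = 0) -> gpiece n v ->
  \sum_(m \in [set: int]) F m (gcomp m v) = F n v.
Proof.
move=> F0 nv; rewrite (@fsum_fset _ _ [fset n]%fset).
  by rewrite big_seq_fset1 (gcomp_hom _ nv) eqxx.
by move=> m; rewrite in_fset1 (gcomp_hom _ nv) => /negbTE ->.
Qed.

End Components.

Section TensorGrading.
Variables (K : fieldType) (V W : gradedType K).

Definition tpiece (n : int) : set (tensor V W) := [set t |
  exists2 s : seq (V * W), t = \sum_(x <- s) x.1 *t x.2 &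
    forall x, x \in s -> exists p q : int,
      [/\ gpiece p x.1, gpiece q x.2 & p + q = n] ].

Lemma tpiece0 n : tpiece n 0.
Proof. by exists [::]; rewrite ?big_nil. Qed.

Lemma tpieceP n a t u : tpiece n t -> tpiece n u -> tpiece n (a *: t + u).
Proof.
move=> [s -> sP] [s' -> s'P]; exists ([seq (a *: x.1, x.2) | x <- s] ++ s').
  rewrite big_cat big_map /= scaler_sumr.
  by congr (_ + _); apply: eq_bigr => x _; rewrite linearZl_LR.
move=> x; rewrite mem_cat => /orP[/mapP[y ys ->]/=|/s'P//].
have [p [q [yp yq pq]]] := sP _ ys; exists p, q; split=> //.
by rewrite -[_ *: _]addr0; apply: gpieceP => //; exact: gpiece0.
Qed.

Definition tproj_pure (n : int) (v : V) (w : W) : tensor V W :=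
  \sum_(p \in [set: int]) gcomp p v *t gcomp (n - p) w.

Lemma tproj_pure_bilinear n : bilinear_for *:%R *:%R (tproj_pure n).
Proof.
split=> [w a v v'|v a w w'].
  have := @gsum_is_linear _ V _ (fun p => applyr (@tpure K V W) (gcomp (n - p) w)).
  exact.
rewrite /tproj_pure; have [A vA] := gcomp_fset v.
have E (u : W) : \sum_(p \in [set: int]) gcomp p v *t gcomp (n - p) u =
    \sum_(p <- A) gcomp p v *t gcomp (n - p) u.
  by apply: fsum_fset => p /vA ->; rewrite linear0l.
rewrite !E /= scaler_sumr -big_split; apply: eq_bigr => p _ /=.
by rewrite !linearP linearDr linearZr_LR.
Qed.

HB.instance Definition _ n := bilinear_isBilinear.Build K V W (tensor V W)
  *:%R *:%R (tproj_pure n) (tproj_pure_bilinear n).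

Definition tproj n := tlift (tproj_pure n).
HB.instance Definition _ n := GRing.Linear.on (tproj n).

Lemma tproj_pure_hom n p q (v : V) (w : W) : gpiece p v -> gpiece q w ->
  tproj n (v *t w) = if n == p + q then v *t w else 0.
Proof.
move=> pv qw; rewrite /tproj tlift_pure /tproj_pure /=.
transitivity (v *t gcomp (n - p) w).
  by apply: (gsum_hom (F := fun m x => x *t gcomp (n - m) w) _ pv) => m; rewrite linear0l.
rewrite (gcomp_hom _ qw) subr_eq [q + p]addrC.
by case: eqP => // _; rewrite linear0r.
Qed.

Lemma tproj_hom n m t : tpiece n t -> tproj m t = if m == n then t else 0.
Proof.
case=> s -> sP; rewrite linear_sum /=; case: eqP => [->|/eqP mn].
  rewrite !big_seq; apply: eq_bigr => x /sP[p [q [px qx pqn]]].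
  by rewrite (tproj_pure_hom _ px qx) pqn eqxx.
rewrite big_seq big1 // => x /sP[p [q [px qx pqn]]].
by rewrite (tproj_pure_hom _ px qx) pqn (negbTE mn).
Qed.

Lemma tpure_piece p q (v : V) (w : W) :
  gpiece p v -> gpiece q w -> tpiece (p + q) (v *t w).
Proof.
move=> pv qw; exists [:: (v, w)]; first by rewrite big_seq1.
by move=> x; rewrite inE => /eqP -> /=; exists p, q.
Qed.

Lemma tensorHW (P : tensor V W -> Prop) : P 0 ->
  (forall s t, P s -> P t -> P (s + t)) ->
  (forall p q v w, gpiece p v -> gpiece q w -> P (v *t w)) -> forall t, P t.
Proof.
move=> P0 PD Ph; have Psum (F : int -> tensor V W) (A : {fset int}) :
    (forall p, P (F p)) -> P (\sum_(p <- A) F p).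
  by move=> PF; elim/big_ind: _.
elim/tensorW => // v w t Pt; apply: PD Pt.
have [A vA] := gcomp_fset v; have [B wB] := gcomp_fset w.
rewrite [v]gcomp_sum [w]gcomp_sum (fsum_fset vA) (fsum_fset wB).
rewrite linear_sumlz; apply: (Psum) => p.
rewrite linear_sumr; apply: Psum => q.
by apply: Ph; exact: gcomp_piece.
Qed.

Lemma tproj_fset t : exists2 A : {fset int},
  forall n, n \notin A -> tproj n t = 0 & t = \sum_(n <- A) tproj n t.
Proof.
have ext (A B : {fset int}) u : (A `<=` B)%fset ->
    (forall n, n \notin A -> tproj n u = 0) ->
    \sum_(n <- A) tproj n u = \sum_(n <- B) tproj n u.
  move=> /fsubsetP AB uA; rewrite -(fsum_fset uA) -(@fsum_fset _ _ B) // => n nB.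
  by apply: uA; apply: contra nB; exact: AB.
elim/tensorHW: t => [|s t [A sA sE] [B tB tE]|p q v w pv qw].
- by exists fset0 => [n _|]; rewrite ?big_seq_fset0 ?linear0.
- exists (A `|` B)%fset => [n|].
    by rewrite in_fsetU negb_or (linearD (tproj n)) /= => /andP[/sA -> /tB ->]; rewrite addr0.
  under eq_bigr => n _ do rewrite (linearD (tproj n)).
  by rewrite big_split /= -(ext A _ s) ?fsubsetUl // -(ext B _ t) ?fsubsetUr // -sE -tE.
exists [fset (p + q)%R]%fset => [n|].
  by rewrite in_fset1 (tproj_pure_hom _ pv qw) => /negbTE ->.
by rewrite big_seq_fset1 (tproj_pure_hom _ pv qw) eqxx.
Qed.

Lemma tproj_piece n t : tpiece n (tproj n t).
Proof.
elim/tensorHW: t => [|s t Ps Pt|p q v w pv qw].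
- by rewrite linear0; exact: tpiece0.
- by rewrite (linearD (tproj n)) /= -[tproj n s]scale1r; exact: tpieceP.
rewrite (tproj_pure_hom _ pv qw); case: eqP => [->|_]; last exact: tpiece0.
exact: tpure_piece.
Qed.

Lemma tpiece_direct t : exists! c : int -> tensor V W,
  [/\ forall n, tpiece n (c n), finite_set [set n | c n != 0]
    & t = \sum_(n \in [set: int]) c n].
Proof.
exists (fun n => tproj n t); split.
  have [A tA tE] := tproj_fset t; split; first by move=> n; exact: tproj_piece.
    exact: finite_supp_sub tA.
  by rewrite (fsum_fset tA).
move=> c [cP /finite_supp_fset[A cA] tE]; apply/funext => n.
rewrite tE (fsum_fset cA) linear_sum /=.
under eq_bigr do rewrite (tproj_hom n (cP _)).
rewrite -(@fsum_fset _ _ A) => [|m /cA ->]; last by case: eqP.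
rewrite (@fsum_fset _ _ [fset n]%fset) ?big_seq_fset1 ?eqxx // => m.
by rewrite in_fset1 eq_sym => /negbTE ->.
Qed.

HB.instance Definition _ := isGraded.Build K (tensor V W)
  tpiece0 tpieceP tpiece_direct.

End TensorGrading.

Section Homogeneous.
Variables (K : fieldType) (V W : gradedType K).

Definition homogeneous (k : int) (f : V -> W) :=
  forall n v, gpiece n v -> gpiece (n + k) (f v).

(* g w, where the part of g of degree |g| is multiplied by (-1)^(|g| p): the
   component of g mapping degree q to degree m has degree m - q. *)
Definition koszul_twist (p : int) (g : V -> W) (w : V) : W :=
  \sum_(q \in [set: int]) \sum_(m \in [set: int])
    (-1) ^ ((m - q) * p) *: gcomp m (g (gcomp q w)).

Variable g : {linear V -> W}.

Lemma koszul_twist_is_linear p : linear (koszul_twist p g).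
Proof.
have lin q : linear (fun x => \sum_(m \in [set: int])
    (-1) ^ ((m - q) * p) *: gcomp m (g x)).
  move=> a u v; rewrite linearP /=.
  exact: (gsum_is_linear (fun m => (((-1) ^ ((m - q) * p) : K) \*: @idfun W))).
pose F q : {linear V -> W} := HB.pack (fun x => \sum_(m \in [set: int])
    (-1) ^ ((m - q) * p) *: gcomp m (g x)) (GRing.isLinear.Build _ _ _ _ _ (lin q)).
exact: (gsum_is_linear F).
Qed.

HB.instance Definition _ p :=
  GRing.isLinear.Build K V W *:%R (koszul_twist p g) (koszul_twist_is_linear p).

Lemma koszul_twist_homogeneous k p w : homogeneous k g ->
  koszul_twist p g w = (-1) ^ (k * p) *: g w.
Proof.
move=> gk; have [A wA] := gcomp_fset w.
rewrite [w in RHS]gcomp_sum (fsum_fset wA) linear_sum scaler_sumr /=.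
rewrite /koszul_twist (@fsum_fset _ _ A) => [|q /wA ->]; last first.
  rewrite linear0 (@fsum_fset _ _ fset0) ?big_seq_fset0 // => m _.
  by rewrite linear0 scaler0.
apply: eq_bigr => q _.
have := gk _ _ (gcomp_piece q w) => /(gsum_hom
  (F := fun m x => (-1) ^ ((m - q) * p) *: x)) -> => [|m]; last by rewrite scaler0.
by rewrite [q + k]addrC addrK.
Qed.

End Homogeneous.

Section KoszulTensor.
Variables (K : fieldType) (V W V' W' : gradedType K).

Definition koszul_pure (f : V -> V') (g : W -> W') (v : V) (w : W) :
  tensor V' W' :=
  \sum_(p \in [set: int]) f (gcomp p v) *t koszul_twist p g w.

Variables (f : {linear V -> V'}) (g : {linear W -> W'}).

Lemma koszul_pure_bilinear : bilinear_for *:%R *:%R (koszul_pure f g).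
Proof.
split=> [w a v v'|v a w w'].
  exact: (gsum_is_linear
    (fun p => (applyr (@tpure K V' W') (koszul_twist p g w)) \o f)).
have [A vA] := gcomp_fset v.
have E (u : W) : koszul_pure f g v u =
    \sum_(p <- A) f (gcomp p v) *t koszul_twist p g u.
  by apply: fsum_fset => p /vA ->; rewrite linear0 linear0l.
rewrite !E /= scaler_sumr -big_split; apply: eq_bigr => p _ /=.
by rewrite (linearP (koszul_twist p g)) /= linearPr.
Qed.

HB.instance Definition _ := bilinear_isBilinear.Build K V W (tensor V' W')
  *:%R *:%R (koszul_pure f g) koszul_pure_bilinear.

(* The Koszul tensor product of f and g, for f and g not necessarily
   homogeneous. *)
Definition ktensor : tensor V W -> tensor V' W' := tlift (koszul_pure f g).

HB.instance Definition _ := GRing.Linear.on ktensor.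

Lemma ktensorE k n v w : homogeneous k g -> gpiece n v ->
  ktensor (v *t w) = (-1) ^ (k * n) *: (f v *t g w).
Proof.
move=> gk nv; rewrite /ktensor tlift_pure /=.
transitivity (f v *t koszul_twist n g w).
  apply: (gsum_hom (F := fun p x => f x *t koszul_twist p g w) _ nv) => p.
  by rewrite linear0 linear0l.
by rewrite (koszul_twist_homogeneous _ _ gk) linearZr_LR.
Qed.

End KoszulTensor.

Notation "f \ox g" := (ktensor f g) (at level 40, left associativity) : ring_scope.

Section Associator.
Variables (K : fieldType) (U V W : gradedType K).

Definition assoc_pure (w : W) (u : U) (v : V) := u *t (v *t w).

Lemma assoc_pure_bilinear w : bilinear_for *:%R *:%R (assoc_pure w).
Proof. by split=> [v a u u'|u a v v']; rewrite /assoc_pure /= linearPl ?linearPr. Qed.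

HB.instance Definition _ w := bilinear_isBilinear.Build K U V
  (tensor U (tensor V W)) *:%R *:%R (assoc_pure w) (assoc_pure_bilinear w).

Definition assoc_curry (t : tensor U V) (w : W) := tlift (assoc_pure w) t.

Lemma assoc_curry_bilinear : bilinear_for *:%R *:%R assoc_curry.
Proof.
split=> [w a s t|t a w w']; rewrite /assoc_curry ?linearP //=.
rewrite /tlift scaler_sumr -big_split; apply: eq_bigr => x _ /=.
by rewrite /assoc_pure !linearPr.
Qed.

HB.instance Definition _ := bilinear_isBilinear.Build K (tensor U V) W
  (tensor U (tensor V W)) *:%R *:%R assoc_curry assoc_curry_bilinear.

(* The canonical identification (u (x) v) (x) w |-> u (x) (v (x) w). *)
Definition tassoc : tensor (tensor U V) W -> tensor U (tensor V W) :=
  tlift assoc_curry.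

HB.instance Definition _ := GRing.Linear.on tassoc.

Lemma tassocE u v w : tassoc (u *t v *t w) = u *t (v *t w).
Proof. by rewrite /tassoc tlift_pure /= /assoc_curry tlift_pure. Qed.

End Associator.

(* V[[hbar]]: x n is the coefficient of hbar ^ n. *)
Definition fps (V : Type) := nat -> V.

(* The hbar-linear map V[[hbar]] -> W[[hbar]] extending \sum_n hbar ^ n F_n. *)
Definition fps_ext (K : fieldType) (V W : lmodType K)
    (F : fps {linear V -> W}) (x : fps V) : fps W :=
  fun n => \sum_(i < n.+1) F i (x (n - i)%N).

Definition fps_const (K : fieldType) (V W : lmodType K) (f : {linear V -> W}) :
  fps {linear V -> W} := fun n => if n is 0 then f else \0.

(* The hbar-expansion of Delta + i hbar (d (x) d) Delta. *)
Definition deformed_coproduct (R : realType) (C : gradedType R[i])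
    (Delta : {linear C -> tensor C C}) (d : {linear C -> C}) :
    fps {linear C -> tensor C C} :=
  fun n => match n with
  | 0 => Delta
  | 1 => 'i%C \*: ((d \ox d) \o Delta)
  | _ => \0
  end.

Lemma deformed_coproductE (R : realType) (C : gradedType R[i])
    (Delta : {linear C -> tensor C C}) (d : {linear C -> C}) (x : fps C) n :
  fps_ext (deformed_coproduct Delta d) x n = Delta (x n) +
    (if n is m.+1 then 'i%C *: (d \ox d) (Delta (x m)) else 0).
Proof.
case: n => [|n]; rewrite /fps_ext big_ord_recl subn0.
  by rewrite big_ord0.
rewrite big_ord_recl /= subSS subn0 [X in _ + (_ + X)]big1 ?addr0 // => i _.
Qed.

(* The factors of the triple tensor product are rebracketed by tassoc. *)
Definition is_coassociative (K : fieldType) (C : gradedType K)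
    (Delta : {linear C -> tensor C C}) :=
  (idfun \ox Delta) \o Delta =1 @tassoc K C C C \o (Delta \ox idfun) \o Delta.

Definition is_coderivation (K : fieldType) (C : gradedType K)
    (Delta : {linear C -> tensor C C}) (d : {linear C -> C}) :=
  Delta \o d =1 ((idfun \ox d) \o Delta) \+ ((d \ox idfun) \o Delta).

Definition fps_coassociative (K : fieldType) (C : gradedType K)
    (D : fps {linear C -> tensor C C}) :=
  fps_ext (fun n => idfun \ox D n) \o fps_ext D =1
  fps_ext (fps_const (@tassoc K C C C)) \o
    fps_ext (fun n => D n \ox idfun) \o fps_ext D.

(* Main.v *)
Require Import Defs.
From mathcomp Require Import all_boot all_order all_algebra.
From mathcomp Require Import reals complex.

(** Write S for the iterated coproduct (id (x) Delta) Delta, which coassociativity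
identifies with (Delta (x) id) Delta, and d1, d2, d3 for d acting on each of the
three factors of C (x) C (x) C, so that these maps commute up to a sign and each
of them has square zero.  The deformed coproduct is a polynomial of degree 1 in
hbar, hence coassociativity amounts to one identity in each of the degrees 0, 1
and 2; the first is the coassociativity of Delta.

In degree 1, both sides are i times a sum of two terms.  Deforming the second
coproduct gives d2 d3 S on one side and d1 d2 S on the other.  Deforming the
first one leaves a Delta applied after d (x) d, and the coderivation property
moves d past it: (id (x) Delta)(d (x) d) Delta = d1 (d2 + d3) S and
(Delta (x) id)(d (x) d) Delta = (d1 + d2) d3 S.  Both totals are
(d1 d2 + d1 d3 + d2 d3) S.

In degree 2, one side is a multiple of d2 d3 d1 (d2 + d3) S and the other of
d1 d2 (d1 + d2) d3 S; every monomial repeats one of the d_i, so both vanish.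

All Koszul signs are contained in two facts about the tensor product of
homogeneous maps: the interchange law [ktensor_comp] and its compatibility with
rebracketing [tassoc_ktensor].  In the interchanges used in degree 1 one of the
two maps that pass each other is Delta or the identity, of degree 0, so no sign
appears there; in degree 2 the signs multiply terms that are zero. *)

Set Implicit Arguments.
Unset Strict Implicit.
Unset Printing Implicit Defensive.

Import GRing.Theory.
Local Open Scope ring_scope.

(** * Homogeneous maps *)

Section Homogeneity.
Variable K : fieldType.

Lemma homogeneous_id (V : gradedType K) : homogeneous 0 (@idfun V).
Proof. by move=> n v; rewrite addr0. Qed.

Lemma homogeneous0 (V W : gradedType K) k : homogeneous k (\0 : V -> W).
Proof. by move=> n v _; exact: gpiece0. Qed.

Lemma homogeneous_comp (U V W : gradedType K) (g : V -> W) (f : U -> V) a b :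
  homogeneous a g -> homogeneous b f -> homogeneous (b + a) (g \o f).
Proof. by move=> ga fb n v nv; rewrite addrA; exact/ga/fb. Qed.

Lemma homogeneousD (V W : gradedType K) (f g : V -> W) a :
  homogeneous a f -> homogeneous a g -> homogeneous a (f \+ g).
Proof.
move=> fa ga n v nv /=; rewrite -[f v]scale1r.
by apply: gpieceP; [exact: fa | exact: ga].
Qed.

Lemma homogeneousZ (V W : gradedType K) (f : V -> W) a c :
  homogeneous a f -> homogeneous a (c \*: f).
Proof.
move=> fa n v nv /=; rewrite -[_ *: _]addr0.
by apply: gpieceP; [exact: fa | exact: gpiece0].
Qed.

Lemma tensor_hom_ext (V W : gradedType K) (U : lmodType K)
    (f g : {linear tensor V W -> U}) :
  (forall p q v w, gpiece p v -> gpiece q w -> f (v *t w) = g (v *t w)) ->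
  f =1 g.
Proof.
move=> fg; elim/tensorHW => [|s t fs ft|p q v w pv qw].
- by rewrite !linear0.
- by rewrite !linearD fs ft.
- exact: fg pv qw.
Qed.

End Homogeneity.

(** * Calculus of the Koszul tensor product *)

Section KoszulCalculus.
Variable K : fieldType.

Lemma homogeneous_ktensor (V W V' W' : gradedType K) (f : {linear V -> V'})
    (g : {linear W -> W'}) a b :
  homogeneous a f -> homogeneous b g -> homogeneous (a + b) (f \ox g).
Proof.
move=> fa gb n _ [s -> sP]; rewrite linear_sum /=.
rewrite big_seq; elim/big_ind: _ => [|x y px py|[v w] /sP[p [q /= [pv qw pq]]]].
- exact: gpiece0.
- by rewrite -[x]scale1r; exact: gpieceP.
rewrite (ktensorE _ _ gb pv) -[_ *: _]addr0.
apply: gpieceP; last exact: gpiece0.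
by rewrite -pq addrACA; apply: tpure_piece; [exact: fa | exact: gb].
Qed.

(** The interchange law: the sign comes from g, of degree b, passing f', of
degree a': when g acts, the vector in front of it has degree p + a' instead
of p. *)
Lemma ktensor_comp (V W V' W' V'' W'' : gradedType K)
    (f : {linear V' -> V''}) (g : {linear W' -> W''})
    (f' : {linear V -> V'}) (g' : {linear W -> W'}) b a' b' :
  homogeneous b g -> homogeneous a' f' -> homogeneous b' g' ->
  forall t, (f \ox g) ((f' \ox g') t) =
    (-1) ^ (b * a') *: ((f \o f') \ox (g \o g')) t.
Proof.
move=> gb fa' gb' t; have ggb := homogeneous_comp gb gb'.
pose lhs : {linear _ -> _} := (f \ox g) \o (f' \ox g').
pose rhs : {linear _ -> _} := (-1) ^ (b * a') \*: ((f \o f') \ox (g \o g')).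
apply: (@tensor_hom_ext _ _ _ _ lhs rhs) => {t} p q v w pv qw /=.
rewrite (ktensorE _ _ gb' pv) linearZ /= (ktensorE _ _ gb (fa' _ _ pv)).
rewrite (ktensorE _ _ ggb pv) /= !scalerA -!expfzDr ?oppr_eq0 ?oner_eq0 //.
by congr (_ ^ _ *: _); rewrite mulrDr mulrDl addrA addrC.
Qed.

Section Arguments.
Variables V W V' W' : gradedType K.

Lemma eq_ktensor (f f' : {linear V -> V'}) (g g' : {linear W -> W'}) b :
  homogeneous b g -> f =1 f' -> g =1 g' -> f \ox g =1 f' \ox g'.
Proof.
move=> gb ff' gg'; have gb' : homogeneous b g'.
  by move=> n v nv; rewrite -gg'; exact: gb.
apply: tensor_hom_ext => p q v w pv qw /=.
by rewrite (ktensorE _ _ gb pv) (ktensorE _ _ gb' pv) ff' gg'.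
Qed.

Lemma ktensorDl (f f' : {linear V -> V'}) (g : {linear W -> W'}) b :
  homogeneous b g -> (f \+ f') \ox g =1 (f \ox g) \+ (f' \ox g).
Proof.
move=> gb; apply: tensor_hom_ext => p q v w pv qw /=.
by rewrite !(ktensorE _ _ gb pv) linearDl scalerDr.
Qed.

Lemma ktensorDr (f : {linear V -> V'}) (g g' : {linear W -> W'}) b :
  homogeneous b g -> homogeneous b g' ->
  f \ox (g \+ g') =1 (f \ox g) \+ (f \ox g').
Proof.
move=> gb gb'; apply: tensor_hom_ext => p q v w pv qw /=.
rewrite (ktensorE _ _ (homogeneousD gb gb') pv).
by rewrite (ktensorE _ _ gb pv) (ktensorE _ _ gb' pv) linearDr scalerDr.
Qed.

Lemma ktensorZl c (f : {linear V -> V'}) (g : {linear W -> W'}) b :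
  homogeneous b g -> (c \*: f) \ox g =1 c \*: (f \ox g).
Proof.
move=> gb; apply: tensor_hom_ext => p q v w pv qw /=.
by rewrite !(ktensorE _ _ gb pv) linearZl_LR !scalerA mulrC.
Qed.

Lemma ktensorZr c (f : {linear V -> V'}) (g : {linear W -> W'}) b :
  homogeneous b g -> f \ox (c \*: g) =1 c \*: (f \ox g).
Proof.
move=> gb; apply: tensor_hom_ext => p q v w pv qw /=.
rewrite (ktensorE _ _ (homogeneousZ _ gb) pv) (ktensorE _ _ gb pv).
by rewrite linearZr_LR !scalerA mulrC.
Qed.

Lemma ktensor0l (g : {linear W -> W'}) b :
  homogeneous b g -> (\0 : {linear V -> V'}) \ox g =1 \0.
Proof.
move=> gb; apply: tensor_hom_ext => p q v w pv qw /=.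
by rewrite (ktensorE _ _ gb pv) linear0l scaler0.
Qed.

Lemma ktensor0r (f : {linear V -> V'}) :
  f \ox (\0 : {linear W -> W'}) =1 \0.
Proof.
apply: tensor_hom_ext => p q v w pv qw /=.
by rewrite (ktensorE _ _ (@homogeneous0 _ W W' 0) pv) linear0r scaler0.
Qed.

End Arguments.

(** How d o d = 0 is used: acting twice on the same tensor factor
gives zero, whatever the maps on the other factor and their sign. *)
Section VanishingComposite.
Variables V W V' W' V'' W'' : gradedType K.
Variables (f : {linear V' -> V''}) (g : {linear W' -> W''}).
Variables (f' : {linear V -> V'}) (g' : {linear W -> W'}) (b a' b' : int).
Hypotheses (g_degree : homogeneous b g) (f'_degree : homogeneous a' f')
  (g'_degree : homogeneous b' g').

Let gg'_degree := homogeneous_comp g_degree g'_degree.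

Lemma ktensor_comp0l : f \o f' =1 \0 -> forall t, (f \ox g) ((f' \ox g') t) = 0.
Proof.
move=> ff'0 t; rewrite (ktensor_comp _ g_degree f'_degree g'_degree).
by rewrite (eq_ktensor gg'_degree ff'0 (frefl _)) (ktensor0l _ gg'_degree) scaler0.
Qed.

Lemma ktensor_comp0r : g \o g' =1 \0 -> forall t, (f \ox g) ((f' \ox g') t) = 0.
Proof.
move=> gg'0 t; rewrite (ktensor_comp _ g_degree f'_degree g'_degree).
by rewrite (eq_ktensor gg'_degree (frefl _) gg'0) ktensor0r scaler0.
Qed.

End VanishingComposite.

(** Both bracketings acquire the same sign: g passes u, and h passes both u and v,
in whichever order the two tensor products are formed. *)
Lemma tassoc_ktensor (U V W U' V' W' : gradedType K) (f : {linear U -> U'})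
    (g : {linear V -> V'}) (h : {linear W -> W'}) b c :
  homogeneous b g -> homogeneous c h ->
  forall t, tassoc (((f \ox g) \ox h) t) = (f \ox (g \ox h)) (tassoc t).
Proof.
move=> gb hc t; have ghbc := homogeneous_ktensor gb hc.
pose lhs : {linear _ -> _} := @tassoc K _ _ _ \o ((f \ox g) \ox h).
pose rhs : {linear _ -> _} := (f \ox (g \ox h)) \o @tassoc K _ _ _.
suff: lhs =1 rhs by exact.
apply: tens_linear_ext => {t} uv w /=; elim/tensorHW: uv => [|s t IHs IHt|].
- by rewrite !linear0l !linear0.
- by rewrite !linearDl !linearD /= IHs IHt.
move=> p q u v pu qv.
rewrite (ktensorE _ _ hc (tpure_piece pu qv)) /= (ktensorE _ _ gb pu) tassocE.
rewrite (ktensorE _ _ ghbc pu) /= (ktensorE _ _ hc qv).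
rewrite linearZl_LR linearZr_LR !linearZ /= tassocE !scalerA.
rewrite -!expfzDr ?oppr_eq0 ?oner_eq0 //; congr (_ ^ _ *: _).
by rewrite mulrDr mulrDl -addrA addrC -addrA.
Qed.

End KoszulCalculus.

(** * Coderivations and the iterated coproduct *)

Section Coderivation.
Variables (K : fieldType) (C : gradedType K).
Variables (Delta : {linear C -> tensor C C}) (d : {linear C -> C}) (k : int).
Hypotheses (Delta_graded : homogeneous 0 Delta) (d_degree : homogeneous k d).

Let id0 := @homogeneous_id K C.

Let dd : {linear C -> tensor C C} := (d \ox d) \o Delta.

Let dxd_degree := homogeneous_ktensor d_degree d_degree.

Let h1d : homogeneous k (@idfun C \ox d).
Proof. by rewrite -[k]add0r; exact: homogeneous_ktensor. Qed.

Let hd1 : homogeneous k (d \ox @idfun C).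
Proof. by rewrite -[k]addr0; exact: homogeneous_ktensor. Qed.

Lemma dd_degree : homogeneous (0 + (k + k)) dd.
Proof. exact: homogeneous_comp dxd_degree Delta_graded. Qed.

(** The next four lemmas push each composite with the coproducts to the right
of the maps built from d, so that the two bracketings become operators applied
to the same iterated coproduct. *)
Lemma id_ktensor_dd (t : tensor C C) :
  (@idfun C \ox dd) t = (@idfun C \ox (d \ox d)) ((@idfun C \ox Delta) t).
Proof.
rewrite (ktensor_comp _ dxd_degree id0 Delta_graded) mulr0 expr0z scale1r.
exact: (eq_ktensor dd_degree).
Qed.

Lemma dd_ktensor_id (t : tensor C C) :
  tassoc ((dd \ox @idfun C) t) = (d \ox (d \ox @idfun C)) (tassoc ((Delta \ox @idfun C) t)).
Proof.
rewrite -(tassoc_ktensor _ d_degree id0).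
rewrite (ktensor_comp _ id0 Delta_graded id0) mulr0 expr0z scale1r.
by congr tassoc; exact: (eq_ktensor id0).
Qed.

Hypothesis d_coderivation : is_coderivation Delta d.

Lemma id_ktensor_Delta (t : tensor C C) :
  (@idfun C \ox Delta) ((d \ox d) t) =
  (d \ox (@idfun C \ox d)) ((@idfun C \ox Delta) t) +
  (d \ox (d \ox @idfun C)) ((@idfun C \ox Delta) t).
Proof.
rewrite (ktensor_comp _ Delta_graded d_degree d_degree) mul0r expr0z scale1r.
rewrite -[RHS](ktensorDr _ h1d hd1) (ktensor_comp _ (homogeneousD h1d hd1) id0 Delta_graded).
rewrite mulr0 expr0z scale1r.
exact: (eq_ktensor (homogeneous_comp Delta_graded d_degree)).
Qed.

Lemma Delta_ktensor_id (t : tensor C C) :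
  tassoc ((Delta \ox @idfun C) ((d \ox d) t)) =
  (@idfun C \ox (d \ox d)) (tassoc ((Delta \ox @idfun C) t)) +
  (d \ox (@idfun C \ox d)) (tassoc ((Delta \ox @idfun C) t)).
Proof.
rewrite -(tassoc_ktensor _ d_degree d_degree) -(tassoc_ktensor _ id0 d_degree).
rewrite -linearD -[X in _ = tassoc X](ktensorDl _ _ d_degree).
rewrite (ktensor_comp _ id0 d_degree d_degree) mul0r expr0z scale1r.
rewrite (ktensor_comp _ d_degree Delta_graded id0) mulr0 expr0z scale1r.
by congr tassoc; exact: (eq_ktensor d_degree).
Qed.

Hypothesis Delta_coassoc : is_coassociative Delta.

(** Both sides are (d1 d2 + d1 d3 + d2 d3) applied to the iterated coproduct. *)
Lemma coassociative_order1 x :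
  (@idfun C \ox Delta) (dd x) + (@idfun C \ox dd) (Delta x) =
  tassoc ((Delta \ox @idfun C) (dd x)) + tassoc ((dd \ox @idfun C) (Delta x)).
Proof.
rewrite id_ktensor_Delta id_ktensor_dd Delta_ktensor_id dd_ktensor_id.
have /= <- := Delta_coassoc x.
by rewrite addrC addrA.
Qed.

Hypothesis d_flat : d \o d =1 \0.

(** The operator is d2 d3 d1 (d2 + d3), and each monomial contains the square
of d2 or of d3. *)
Lemma coassociative_order2l x : (@idfun C \ox dd) (dd x) = 0.
Proof.
rewrite id_ktensor_dd id_ktensor_Delta linearD /=.
rewrite (ktensor_comp0r _ dxd_degree d_degree h1d); last first.
  by move=> t; exact: ktensor_comp0r d_degree id0 d_degree d_flat t.
rewrite (ktensor_comp0r _ dxd_degree d_degree hd1) ?addr0 // => t.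
exact: ktensor_comp0l d_degree d_degree id0 d_flat t.
Qed.

(** The operator is d1 d2 (d1 + d2) d3, and each monomial contains the square
of d1 or of d2. *)
Lemma coassociative_order2r x : tassoc ((dd \ox @idfun C) (dd x)) = 0.
Proof.
rewrite dd_ktensor_id Delta_ktensor_id linearD /=.
rewrite (ktensor_comp0l hd1 d_degree h1d d_flat) addr0.
apply: (ktensor_comp0r _ hd1 id0 dxd_degree) => t.
exact: ktensor_comp0l id0 d_degree d_degree d_flat t.
Qed.

End Coderivation.

(** * Coefficients of power series maps *)

Section PowerSeries.
Variables (K : fieldType) (V W : lmodType K).

Lemma fps_ext_const (f : {linear V -> W}) x n :
  fps_ext (fps_const f) x n = f (x n).
Proof. by rewrite /fps_ext big_ord_recl subn0 big1 ?addr0. Qed.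

Lemma fps_ext_degree1 (F : fps {linear V -> W}) x n :
  (forall m, F m.+2 =1 \0) ->
  fps_ext F x n = F 0%N (x n) + (if n is m.+1 then F 1%N (x m) else 0).
Proof.
move=> F0; case: n => [|n]; rewrite /fps_ext big_ord_recl subn0.
  by rewrite big_ord0.
by rewrite big_ord_recl subSS subn0 [X in _ + (_ + X)]big1 ?addr0 // => i _; rewrite F0.
Qed.

End PowerSeries.

(** * Coassociativity of the deformed coproduct *)

Theorem proposition3p0p1 (R : realType) (C : gradedType R[i])
    (Delta : {linear C -> tensor C C}) (d : {linear C -> C}) (k : int)
    (Delta_graded : homogeneous 0 Delta)
    (Delta_coassoc : is_coassociative Delta)
    (k_odd : odd `|k|%N)
    (d_degree : homogeneous k d)
    (d_flat : d \o d =1 \0)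
    (d_coderivation : is_coderivation Delta d) :
  fps_coassociative (deformed_coproduct Delta d) /\
  (forall x : fps C,
     fps_ext (deformed_coproduct Delta d) x 0%N = Delta (x 0%N)).
Proof.
split=> [x|x]; last by rewrite deformed_coproductE addr0.
have id0 := @homogeneous_id _ C.
have dd_deg := dd_degree Delta_graded d_degree.
have idDE y n : fps_ext (fun m => @idfun C \ox deformed_coproduct Delta d m) y n =
    (idfun \ox Delta) (y n) +
    (if n is m.+1 then 'i%C *: (idfun \ox ((d \ox d) \o Delta)) (y m) else 0).
  rewrite fps_ext_degree1; last by move=> m; exact: ktensor0r.
  by case: n => // n; congr (_ + _); exact: ktensorZr dd_deg _.
have DidE y n : fps_ext (fun m => deformed_coproduct Delta d m \ox @idfun C) y n =
    (Delta \ox idfun) (y n) +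
    (if n is m.+1 then 'i%C *: (((d \ox d) \o Delta) \ox idfun) (y m) else 0).
  rewrite fps_ext_degree1; last by move=> m; exact: ktensor0l id0.
  by case: n => // n; congr (_ + _); exact: ktensorZl id0 _.
have order0 y := Delta_coassoc y.
have order1 y := coassociative_order1 Delta_graded d_degree d_coderivation
  Delta_coassoc y.
have order2l y := coassociative_order2l Delta_graded d_degree d_coderivation d_flat y.
have order2r y := coassociative_order2r Delta_graded d_degree d_coderivation d_flat y.
rewrite /= in order0 order1 order2l order2r.
apply: boolp.funext => n; rewrite [RHS]fps_ext_const /= idDE DidE.
case: n => [|n]; rewrite !deformed_coproductE; first by rewrite !addr0.
(* The hbar term of the inner coproduct, where it meets the hbar term of the
outer one: it contributes in degree 2 and is sent to zero, which leaves the
identities of degrees 0 and 1. *)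
set tail := (match n with 0%N => 0 | m.+1 => _ end).
have tail_l : (idfun \ox ((d \ox d) \o Delta)) tail = 0.
  rewrite /tail {tail}; case: n => [|m]; first by rewrite linear0.
  by rewrite linearZ /= order2l scaler0.
have tail_r : tassoc ((((d \ox d) \o Delta) \ox idfun) tail) = 0.
  rewrite /tail {tail tail_l}; case: n => [|m]; first by rewrite !linear0.
  by rewrite !linearZ /= order2r scaler0.
rewrite !(linearD, linearZ) /= tail_l tail_r scaler0 !addr0 order0 -!addrA; congr (_ + _).
by rewrite -!scalerDr order1.
Qed.
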